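(* Let $X$ be a Hilbert space and let $E$ be a nonempty subset of $X$. There exist a (not necessarily linear) operator $\mathcal{E}:\mathcal{J}^{1,\omega}_b(E)\to C^{1,\omega}_b(X)$ and a constant $C>0$, depending only on $\omega$ (in particular not on $X$ or $E$), with the following properties: (1) $(\mathcal{E}(f,G),\nabla\mathcal{E}(f,G))_{|_E}=(f,G)$ for every $(f,G)\in\mathcal{J}^{1,\omega}_b(E)$; (2) $\|\mathcal{E}(f,G)\|_{1,\omega,b}\le C\,\rho(f,G)$ for all $(f,G)\in\mathcal{J}^{1,\omega}_b(E)$.
   Context: Spaces are real; $|\cdot|$ is the norm of $X$. $\omega:[0,\infty)\to[0,\infty)$ is a modulus of continuity: a concave, increasing, continuous function with $\omega(0)=0$ and $\lim_{t\to\infty}\omega(t)=\infty$. Put $\varphi(t)=\int_0^t\omega(s)\,ds$. $C^{1,\omega}(X)$ is the set of Fréchet differentiable $h:X\to\mathbb{R}$ with $M_\omega(\nabla h):=\sup_{x\ne y}\frac{|\nabla h(x)-\nabla h(y)|}{\omega(|x-y|)}<\infty$. $C^{1,\omega}_b(X)$ is the set of $h\in C^{1,\omega}(X)$ such that $h$ and $\nabla h$ are bounded on $X$, with norm $\|h\|_{1,\omega,b}=\|h\|_\infty+\|\nabla h\|_\infty+M_\omega(\nabla h)$. For $f:E\to\mathbb{R}$, $G:E\to X$, $$A(f,G)=\sup_{x\in X;\ y,z\in E,\ |x-y|+|x-z|>0}\frac{|f(y)+\langle G(y),x-y\rangle-f(z)-\langle G(z),x-z\rangle|}{\varphi(|x-y|)+\varphi(|x-z|)}.$$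 $\mathcal{J}^{1,\omega}_b(E)$ is the vector space of pairs $(f,G):E\to\mathbb{R}\times X$ with $A(f,G)<\infty$ and $f$, $G$ bounded on $E$, with norm $\rho(f,G)=\|f\|_\infty+\|G\|_\infty+A(f,G)$ (sup norms over $E$). *)

(* Defs.v *)
From HB Require Import structures.
From mathcomp Require Import all_boot all_order all_algebra.
From mathcomp Require Import sesquilinear.
From mathcomp Require Import all_classical all_reals all_analysis.
Export numFieldNormedType.Exports.

Set Implicit Arguments.
Unset Strict Implicit.
Unset Printing Implicit Defensive.

Import Order.TTheory GRing.Theory Num.Theory.

Local Open Scope classical_set_scope.
Local Open Scope ring_scope.

(* A real Hilbert space is a complete normed module [X] together with a
   positive definite symmetric bilinear form that induces its norm. *)
Definition induces_norm (R : realType) (X : normedModType R)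
    (dot : {dot X for idfun}) : Prop :=
  forall x : X, dot x x = `|x| ^+ 2.

(* [omega] is a total function on [R], but only its restriction to [0, +oo[ is
   constrained, and only that restriction is used below. *)
Record modulus_of_continuity (R : realType) (omega : R -> R) : Prop := {
  modulus_ge0 : forall t, 0 <= t -> 0 <= omega t;
  modulus0 : omega 0 = 0;
  modulus_concave :
    convex_function (E := R^o) `[0, +oo[ (fun t => - omega t);
  modulus_increasing :
    {in `[0, +oo[ &, {homo omega : s t / s <= t}};
  modulus_continuous : {within `[0, +oo[, continuous omega};
  modulus_cvgy : omega t @[t --> +oo] --> +oo }.

Definition primitive0 (R : realType) (omega : R -> R) (t : R) : R :=
  \int[lebesgue_measure]_(s in `[0, t]) omega s.

(* Supremum in [0, +oo] of a set of nonnegative numbers. Adding 0 to the set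
   only matters when the set is empty: the sets in [grad_seminorm] and
   [jet_seminorm] are empty when X = {0}, and [ereal_sup set0] is -oo. *)
Definition sup_ge0 (R : realType) (S : set R) : \bar R :=
  ereal_sup (0%E |` (EFin @` S)).

Definition sup_norm (R : realType) (T : Type) (V : normedModType R)
    (f : T -> V) : \bar R :=
  sup_ge0 [set `|f x| | x in setT].

Section Spaces.
Context (R : realType) (X : completeNormedModType R).
Variables (dot : {dot X for idfun}) (omega : R -> R).
Local Notation phi := (primitive0 omega).

(* The Riesz representative of the Frechet differential of [h] at [x]. When
   [dot] induces the norm and [h] is differentiable at [x], it exists and is
   unique, so the default value 0 plays no role. *)
Definition gradient (h : X -> R) (x : X) : X :=
  xget 0 [set g : X | forall v : X, 'd h x v = dot g v].

Definition grad_seminorm (h : X -> R) : \bar R :=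
  sup_ge0 [set r : R | exists x y : X, x <> y /\
    r = `|gradient h x - gradient h y| / omega `|x - y|].

Definition C1 : set (X -> R) :=
  [set h | (forall x, differentiable h x) /\ (grad_seminorm h < +oo)%E].

Definition C1b : set (X -> R) :=
  [set h | [/\ C1 h, bounded_fun h & bounded_fun (gradient h)]].

Definition C1b_norm (h : X -> R) : \bar R :=
  (sup_norm h + sup_norm (gradient h) + grad_seminorm h)%E.

Variable E : set X.

Definition jet_seminorm (f : E -> R) (G : E -> X) : \bar R :=
  sup_ge0 [set r : R | exists (x : X) (y z : E),
    0 < `|x - val y| + `|x - val z| /\
    r = `|f y + dot (G y) (x - val y) - f z - dot (G z) (x - val z)| /
        (phi `|x - val y| + phi `|x - val z|)].

Definition jets_b : set ((E -> R) * (E -> X)) :=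
  [set fG | [/\ (jet_seminorm fG.1 fG.2 < +oo)%E,
                bounded_fun fG.1 & bounded_fun fG.2]].

Definition jets_b_norm (fG : (E -> R) * (E -> X)) : \bar R :=
  (sup_norm fG.1 + sup_norm fG.2 + jet_seminorm fG.1 fG.2)%E.

End Spaces.

(* Main.v *)
Require Import Defs.
From HB Require Import structures.
From mathcomp Require Import all_boot all_order all_algebra.
From mathcomp Require Import sesquilinear ring lra.
From mathcomp Require Import all_classical all_reals all_analysis.
Import Order.TTheory GRing.Theory Num.Theory.

(** Write [phi] for the primitive of [omega] and let [M] be the norm of the jet
[(f, G)]. Each [y] in [E] gives a barrier from above and one from below,
  [f y + <G y, x - y> + M phi|x - y|]  and  [f y + <G y, x - y> - M phi|x - y|],
and finiteness of the jet seminorm says that every lower barrier stays below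
every upper one. At [y] itself the two barriers of [y] touch, with common value
[f y] and common slope [G y], so any function squeezed between the two families
extends the jet, provided that it is regular.

Regularity is measured by paraconvexity: [h] is [K]-paraconvex when it fails to
be convex, at a point [x] and along [x + a], [x + b] with barycenter [x], by at
most [K] times the same average of [phi|a|] and [phi|b|]. A function [F] such
that [F] and [- F] are both [K]-paraconvex is [C^{1,omega}]. Its difference
quotients from the left and from the right are then close to each other, hence
converge, and the limit is a linear form with
[|F (x + v) - F x - D_x v| <= K phi|v|]; comparing three such expansions bounds
[D_x - D_y] by [6 K omega|x - y|]. Combinations with arbitrary weights matter
here: second differences of size [phi] alone do not give a [C^{1,omega}]
function when [omega] violates the Dini condition.

In a Hilbert space [phi|.|] lies below its tangents up to [12 phi]
([primitive0_norm_tangent]), so lower barriers are [12 M]-paraconvex and so are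
the opposites of upper barriers. It remains to insert a regular function between
the two families ([paraconvex_insertion]). Take [F] to be the supremum of all
[K]-paraconvex functions below the upper barriers; it is again [K]-paraconvex.
For fixed weights and increments [a], [b], the function averaging
[F (. + a)] and [F (. + b)] and subtracting [K] times the average of [phi|a|] and
[phi|b|] is [K]-paraconvex too, because this notion is invariant under
translation, and it is below the upper barriers because these are paraconcave.
So it is below [F] by maximality, which says exactly that [- F] is
[K]-paraconvex.

Boundedness comes from adding constants to both families. As [omega] tends to
infinity, [t - phi t] is bounded by some [T], so every lower barrier is at most
[N = M (1 + T)] and every upper one at least [- N]. With [N] as an upper barrier
and [- N] as a lower one, [|F| <= N], and the expansion at unit increments
bounds the gradient. All constants are multiples of [M] by numbers that depend
on [omega] only. *)

Set Implicit Arguments.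
Unset Strict Implicit.
Unset Printing Implicit Defensive.

Local Open Scope classical_set_scope.
Local Open Scope ring_scope.

(** * Moduli of continuity and their primitives *)

Section Modulus.
Context {R : realType} {omega : R -> R} (homega : modulus_of_continuity omega).
Local Notation phi := (primitive0 omega).

Lemma modulus_star (c t : R) : 0 <= c <= 1 -> 0 <= t -> c * omega t <= omega (c * t).
Proof.
move=> /andP[c0 c1] t0.
have c01 : Itv.spec (@Itv.num_sem R) (Itv.Real `[0%Z, 1%Z]) c.
  by rewrite /Itv.spec/= /Itv.num_sem/= realE c0 in_itv/= c0 c1.
have := modulus_concave homega (Itv.mk c01) (x := t) (y := 0).
rewrite !inE/= !in_itv/= t0 lexx => /(_ isT isT).
by rewrite !convRE/= /conv/= scaler0 addr0 (modulus0 homega) /GRing.scale/=; lra.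
Qed.

Lemma modulus_le (s t : R) : 0 <= s -> s <= t -> omega s <= omega t.
Proof.
move=> s0 st; apply: (modulus_increasing homega) => //; rewrite in_itv/= andbT //.
exact: le_trans st.
Qed.

(** A concave function vanishing at 0 has nonincreasing chord slopes
[omega t / t]; the product form avoids dividing by 0. *)
Lemma modulus_slope (s t : R) : 0 <= s -> s <= t -> s * omega t <= t * omega s.
Proof.
move=> s0 st; have [t0|t0] := ltP 0 t; last first.
  by have [-> ->] : s = 0 /\ t = 0 by split; lra.
have := @modulus_star (s / t) t; rewrite divr_ge0 ?(ltW t0)//= ler_pdivrMr//.
rewrite mul1r divfK ?gt_eqF// => /(_ st isT).
by rewrite mulrAC ler_pdivrMr// [t * _]mulrC.
Qed.

Lemma modulus_subadd (s t : R) : 0 <= s -> 0 <= t -> omega (s + t) <= omega s + omega t.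
Proof.
move=> s0 t0; have st0 := addr_ge0 s0 t0.
have [st|st] := ltP 0 (s + t); last first.
  have [-> ->] : s = 0 /\ t = 0 by split; lra.
  by rewrite addr0 (modulus0 homega) addr0.
rewrite -(ler_pM2l st) mulrDr -{1}(mulr1 (s + t)).
have h1 := @modulus_slope s (s + t) s0 ltac:(lra).
have h2 := @modulus_slope t (s + t) t0 ltac:(lra).
rewrite mulr1; lra.
Qed.

Lemma modulus_unbounded (A : R) : exists2 T, 0 < T & A <= omega T.
Proof.
have := modulus_cvgy homega => /cvgryPge/(_ A) [M [Mr HM]].
exists (`|M| + 1); first by have := normr_ge0 M; lra.
by apply: HM; have := ler_norm M; lra.
Qed.

Lemma modulus_gt0 (t : R) : 0 < t -> 0 < omega t.
Proof.
move=> t0; have [T T0 HT] := modulus_unbounded 1.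
have [tT|/ltW Tt] := leP t T.
  rewrite -(pmulr_rgt0 _ T0).
  apply: lt_le_trans (@modulus_slope t T (ltW t0) tT).
  by apply: mulr_gt0 => //; lra.
by apply: lt_le_trans (modulus_le (ltW T0) Tt); lra.
Qed.

Lemma modulus_small (e : R) : 0 < e -> exists2 d, 0 < d & omega d <= e.
Proof.
move=> e0.
have A0 : `[0, +oo[%classic (0 : R) by rewrite /= in_itv/= lexx.
have /subspace_continuousP/(_ 0 A0)/cvgrPdist_le/(_ e e0) := modulus_continuous homega.
case=> d/= d0 Hd; exists (d / 2); first by lra.
have h : `|omega 0 - omega (d / 2)| <= e.
  apply: Hd; last by rewrite in_itv/= andbT; lra.
  by rewrite /ball_/= sub0r normrN gtr0_norm; lra.
move: h; rewrite (modulus0 homega) sub0r normrN; apply: le_trans; exact: ler_norm.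
Qed.

Lemma modulus_integrable (a b : R) : 0 <= a ->
  lebesgue_measure.-integrable `[a, b] (EFin \o omega).
Proof.
move=> a0; apply: continuous_compact_integrable; first exact: segment_compact.
apply: continuous_subspaceW (modulus_continuous homega).
by move=> x/=; rewrite !in_itv/= => /andP[ax _]; rewrite (le_trans a0 ax).
Qed.

Lemma primitive0_0 : phi 0 = 0.
Proof. by rewrite /primitive0 set_itv1 Rintegral_set1. Qed.

(** With [phi 0 = 0], the only fact about the integral from which the other
estimates on its values are derived. *)
Lemma primitive0_slope (a b : R) : 0 <= a -> a <= b ->
  (b - a) * omega a <= phi b - phi a <= (b - a) * omega b.
Proof.
move=> a0 ab; rewrite /primitive0.
rewrite (@Rintegral_itvB _ omega (BLeft 0) (BRight b) a) ?bnd_simp//;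
  last exact: modulus_integrable.
have iab := @modulus_integrable a b a0.
have iab' : lebesgue_measure.-integrable `]a, b] (EFin \o omega).
  by apply: (integrableS _ _ _ iab) => //; exact: subset_itv_oc_cc.
rewrite (Rintegral_itv_obnd_cbnd iab').
have mE : fine (lebesgue_measure `[a, b]%classic) = b - a.
  by rewrite lebesgue_measure_itv/= lte_fin; case: ltgtP ab => //= -> _; rewrite subrr.
have icst c : lebesgue_measure.-integrable `[a, b] (EFin \o (fun=> c : R)).
  apply: continuous_compact_integrable; first exact: segment_compact.
  by apply: continuous_subspaceT => x; exact: cvg_cst.
have mI : measurable (`[a, b]%classic : set R) by [].
rewrite -mE ![fine _ * _]mulrC -!(Rintegral_cst lebesgue_measure mI).
apply/andP; split; apply: le_Rintegral => //=.
  by move=> x; rewrite in_itv/= => /andP[ax xb]; exact: modulus_le.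
move=> x; rewrite in_itv/= => /andP[ax xb]; apply: modulus_le => //; exact: le_trans ax.
Qed.

Lemma primitive0_le (s t : R) : 0 <= s -> s <= t -> phi s <= phi t.
Proof.
move=> s0 st; have /andP[+ _] := primitive0_slope s0 st.
have := mulr_ge0 (_ : 0 <= t - s) (modulus_ge0 homega s0); rewrite subr_ge0 => /(_ st).
lra.
Qed.

Lemma primitive0_ge0 (t : R) : 0 <= t -> 0 <= phi t.
Proof. by move=> t0; rewrite -primitive0_0 primitive0_le. Qed.

Lemma primitive0_upper (t : R) : 0 <= t -> phi t <= t * omega t.
Proof.
move=> t0; have /andP[_] := primitive0_slope (lexx 0) t0.
by rewrite primitive0_0 !subr0.
Qed.

(** Together with [primitive0_upper], [phi t] is comparable to [t * omega t]: it
suffices to integrate over the upper half of [[0, t]], where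
[omega >= omega (t / 2) >= omega t / 2]. *)
Lemma primitive0_lower (t : R) : 0 <= t -> t * omega t <= 4 * phi t.
Proof.
move=> t0; have t20 : 0 <= t / 2 by lra.
have /andP[h1 _] := @primitive0_slope (t / 2) t t20 ltac:(lra).
have h2 := primitive0_ge0 t20.
have h3 := @modulus_slope (t / 2) t t20 ltac:(lra).
have := ler_wpM2l t20 (modulus_ge0 homega t20).
have -> : 4 * phi t = 4 * (phi t - phi (t / 2)) + 4 * phi (t / 2) by ring.
lra.
Qed.

Lemma primitive0_gt0 (t : R) : 0 < t -> 0 < phi t.
Proof.
move=> t0; have := primitive0_lower (ltW t0).
have := mulr_gt0 t0 (modulus_gt0 t0); lra.
Qed.

(** One-dimensional form of the regularity of [phi]: its derivative [omega]
varies by at most [omega |s - r|] between [r] and [s], by subadditivity. *)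
Lemma primitive0_tangent (r s : R) : 0 <= r -> 0 <= s ->
  phi s - phi r <= omega r * (s - r) + 4 * phi `|s - r|.
Proof.
move=> r0 s0; have hl := primitive0_lower (normr_ge0 (s - r)).
apply: le_trans (_ : omega r * (s - r) + `|s - r| * omega `|s - r| <= _); last by lra.
have [rs|/ltW sr] := leP r s.
  rewrite ger0_norm ?subr_ge0//.
  have /andP[_ h] := primitive0_slope r0 rs; apply: (le_trans h).
  have sr0 : 0 <= s - r by lra.
  have := ler_wpM2l sr0 (modulus_subadd r0 sr0).
  rewrite [r + (s - r)]addrC subrK; lra.
rewrite ler0_norm ?subr_le0// opprB.
have /andP[h _] := primitive0_slope s0 sr.
have rs0 : 0 <= r - s by lra.
have := ler_wpM2l rs0 (modulus_subadd s0 rs0).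
rewrite [s + (r - s)]addrC subrK; lra.
Qed.

(** This is where [omega] tending to infinity is used: once [omega t >= 4],
[primitive0_lower] gives [phi t >= t]. The bound keeps barriers with bounded
slope above, or below, a constant. *)
Lemma primitive0_superlinear : exists2 T, 0 < T & forall t, 0 <= t -> t - phi t <= T.
Proof.
have [T T0 HT] := modulus_unbounded 4; exists T => // t t0.
have [tT|/ltW Tt] := leP t T; first by have := primitive0_ge0 t0; lra.
have h1 := primitive0_lower t0; have h2 := modulus_le (ltW T0) Tt.
have := ler_wpM2l t0 (le_trans HT h2); lra.
Qed.


Lemma primitive0_little (c e : R) : 0 <= c -> 0 < e ->
  exists2 d, 0 < d & forall s, 0 <= s <= d -> phi (s * c) <= s * e.
Proof.
move=> c0 e0; have c1 : 0 < c + 1 by lra.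
have [d d0 wd] := modulus_small (divr_gt0 e0 c1).
exists (d / (c + 1)); first exact: divr_gt0.
move=> s /andP[s0]; rewrite ler_pdivlMr// => sd.
have sc0 : 0 <= s * c by exact: mulr_ge0.
apply: (le_trans (primitive0_upper sc0)).
rewrite -mulrA ler_wpM2l//.
have wsc : omega (s * c) <= e / (c + 1).
  by apply: le_trans wd; apply: modulus_le => //; lra.
apply: (le_trans (ler_wpM2l c0 wsc)).
by rewrite mulrA ler_pdivrMr// mulrC; lra.
Qed.

(** Errors of size [phi] are [o(t)]; this identifies limits of difference
quotients without mentioning limits. *)
Lemma primitive0_negligible (A K c : R) : 0 <= K -> 0 <= c ->
  (forall t, 0 < t -> t * A <= K * phi (t * c)) -> A <= 0.
Proof.
move=> K0 c0 H; apply/ler_addgt0Pr => e e0; rewrite add0r.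
have K1 : 0 < K + 1 by lra.
have [d d0 Hd] := primitive0_little c0 (divr_gt0 e0 K1).
have := H d d0; have := Hd d; rewrite (ltW d0) lexx => /(_ isT) h1 h2.
rewrite -(ler_pM2l d0); apply: (le_trans h2); apply: (le_trans (ler_wpM2l K0 h1)).
rewrite mulrCA ler_pM2l// mulrCA ler_piMr ?(ltW e0)// ler_pdivrMr//; lra.
Qed.
End Modulus.

(** * Inner products and the Riesz representation theorem *)

Section Hilbert.
Context {R : realType} {X : completeNormedModType R} {dot : {dot X for idfun}}.
Context (hdot : induces_norm dot).

Lemma dotC (x y : X) : dot x y = dot y x.
Proof. by rewrite hermC expr0 mul1r. Qed.

Lemma dotZl (c : R) (x y : X) : dot (c *: x) y = c * dot x y.
Proof. exact: linearZl_LR. Qed.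

Lemma dotZr (c : R) (x y : X) : dot x (c *: y) = c * dot x y.
Proof. by rewrite dotC dotZl dotC. Qed.

Lemma sqr_normD (x y : X) : `|x + y| ^+ 2 = `|x| ^+ 2 + 2 * dot x y + `|y| ^+ 2.
Proof. by rewrite -!hdot linearDl !linearDr /= (dotC y x); ring. Qed.

(** Cauchy-Schwarz. *)
Lemma dot_norm_le (x y : X) : `|dot x y| <= `|x| * `|y|.
Proof.
have dot_le u v : dot u v <= `|u| * `|v|.
  have := sqr_normD (`|v| *: u) (- (`|u| *: v)).
  rewrite linearNr /= dotZl dotZr normrN !normrZ !normr_id => e.
  have := sqr_ge0 `|(`|v| *: u - `|u| *: v)|.
  have [/normr0P/eqP ->|u0] := eqVneq `|u| 0; first by rewrite linear0l normr0 mul0r.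
  have [/normr0P/eqP ->|v0] := eqVneq `|v| 0; first by rewrite linear0r normr0 mulr0.
  have uv : 0 < `|u| * `|v| by rewrite mulr_gt0// lt_neqAle eq_sym ?u0 ?v0/=.
  by rewrite e => h; rewrite -(ler_pM2l uv); lra.
by rewrite ler_norml lerNl -linearNl -(normrN x) !dot_le normrN dot_le.
Qed.

Lemma dot_inj (g g' : X) : (forall v, dot g v = dot g' v) -> g = g'.
Proof.
move=> gg; apply/subr0_eq/eqP; rewrite -normr_eq0 -sqrf_eq0 -hdot.
by rewrite linearBl /= gg subrr.
Qed.

(** Riesz representation: the representative minimizes [|v|^2 - 2 D v]. A
minimizing sequence is Cauchy by the parallelogram identity, and near-minimality
along lines makes [dot (u n)] close to [D]. *)
Lemma riesz (D : X -> R) (B : R) :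
    (forall u v, D (u + v) = D u + D v) -> (forall c v, D (c *: v) = c * D v) ->
    (forall v, `|D v| <= B * `|v|) ->
  exists g : X, forall v, D v = dot g v.
Proof.
move=> DD DZ DB.
pose J v := `|v| ^+ 2 - 2 * D v.
have JE u v : J (u + v) = J u + 2 * (dot u v - D v) + `|v| ^+ 2.
  by rewrite /J sqr_normD DD; ring.
have J_bounded : has_inf (range J).
  split; first by exists (J 0), 0.
  exists (- B ^+ 2) => _ [v _ <-]; rewrite /J.
  have := DB v; have := ler_norm (D v); have := sqr_ge0 (`|v| - B); lra.
set m := inf (range J).
have J_ge v : m <= J v by apply: ge_inf; [exact: J_bounded.2|exists v].
have /choice[u Ju] (n : nat) : exists v, J v < m + n.+1%:R^-1.
  have [|_ [v _ <-]] := inf_adherent (_ : 0 < n.+1%:R^-1) J_bounded; first by rewrite invr_gt0.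
  by move=> h; exists v.
have crit n v : (dot (u n) v - D v) ^+ 2 <= n.+1%:R^-1 * `|v| ^+ 2.
  set c := dot (u n) v - D v; set e : R := n.+1%:R^-1.
  have [/normr0P/eqP v0|v0] := eqVneq `|v| 0.
    have D0 : D 0 = 0 by rewrite -(scale0r (0 : X)) DZ mul0r.
    by rewrite /c v0 linear0r D0 subrr normr0 !expr0n mulr0.
  have vv : 0 < `|v| ^+ 2 by rewrite exprn_gt0 // lt_neqAle eq_sym v0 /=.
  (* The step [c / |v|^2] along [- v] minimizes [J] on the line. *)
  have := J_ge (u n + - (c / `|v| ^+ 2) *: v); have := Ju n.
  rewrite JE dotZr DZ normrZ exprMn real_normK ?num_real// -mulrBr -/c -/e => h1 h2.
  have : 2 * (- (c / `|v| ^+ 2) * c) + (- (c / `|v| ^+ 2)) ^+ 2 * `|v| ^+ 2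
    = - (c ^+ 2 / `|v| ^+ 2).
    by field; exact: v0.
  move=> h3; have : c ^+ 2 / `|v| ^+ 2 <= e by lra.
  by rewrite ler_pdivrMr.
have close n p : `|u n - u p| ^+ 2 <= 2 * (n.+1%:R^-1 + p.+1%:R^-1).
  have e : J (u n) + J (u p) = 2 * J (2^-1 *: (u n + u p)) + `|u n - u p| ^+ 2 / 2.
    rewrite /J DZ DD normrZ exprMn !sqr_normD linearNr/= normrN gtr0_norm ?invr_gt0//.
    by field.
  have := J_ge (2^-1 *: (u n + u p)); have := Ju n; have := Ju p; move: e.
  move: (n.+1%:R^-1) (p.+1%:R^-1) (J (u n)) (J (u p)) (J (2^-1 *: _)) (`|u n - u p| ^+ 2).
  by move=> *; lra.
have small (e : R) : 0 < e -> \forall n \near \oo, n.+1%:R^-1 <= e.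
  by move=> e0; apply: filterS (near_infty_natSinv_lt (PosNum e0)) => n /ltW.
have /cauchy_cvg/cvg_ex[g ug] : cauchy (u @ \oo).
  apply: cauchy_exP => e e0.
  have e8 : 0 < e ^+ 2 / 8 by rewrite divr_gt0 ?exprn_gt0.
  have [N _ HN] := small _ e8.
  exists (u N), N => // n /= Nn; rewrite -ball_normE/=.
  rewrite -(@ltr_pXn2r _ 2) ?nnegrE ?(ltW e0)//.
  move: e8 (close N n) (HN _ (leqnn N)) (HN _ Nn).
  by move: (n.+1%:R^-1) (N.+1%:R^-1) (`|u N - u n| ^+ 2) (e ^+ 2) => *; lra.
exists g => v.
suff H (e : R) : 0 < e -> `|dot g v - D v| <= e.
  apply/esym/subr0_eq/eqP; rewrite -normr_le0; apply/ler_addgt0Pr => e /H.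
  by rewrite add0r.
move=> e0; pose e' := e / (2 * (`|v| + 1)).
have v1 : 0 < `|v| + 1 by rewrite ltr_wpDl.
have e'0 : 0 < e' by rewrite divr_gt0// mulr_gt0.
have ee : e = e' * (`|v| + 1) * 2 by rewrite /e'; field; exact: lt0r_neq0.
clearbody e'.
have [n [n1 n2]] : exists n, `|g - u n| <= e' /\ n.+1%:R^-1 <= e' ^+ 2.
  apply: (@filter_ex _ \oo).
  apply: filterI; last exact/small/exprn_gt0.
  by move/cvgrPdist_le : ug; exact.
have h1 : `|dot (u n) v - D v| <= e' * `|v|.
  rewrite -(@ler_pXn2r _ 2) ?nnegrE ?mulr_ge0 ?(ltW e'0)//.
  rewrite real_normK ?num_real// exprMn; apply: (le_trans (crit n v)).
  by rewrite ler_wpM2r ?sqr_ge0.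
have h2 : `|dot (g - u n) v| <= e' * `|v|.
  by apply: (le_trans (dot_norm_le _ _)); rewrite ler_wpM2r.
have -> : dot g v - D v = dot (g - u n) v + (dot (u n) v - D v).
  by rewrite linearBl/= addrA subrK.
apply: (le_trans (ler_normD _ _)); apply: (le_trans (lerD h2 h1)).
rewrite [leRHS]ee; have := mulr_ge0 (ltW e'0) (normr_ge0 v); lra.
Qed.
End Hilbert.

(** * Paraconvex functions and insertion *)

Section Paraconvex.
Context {R : realType} {X : normedModType R} {omega : R -> R}.
Context (homega : modulus_of_continuity omega).
Local Notation phi := (primitive0 omega).

(** The error is measured from the barycenter [x] with the same weights as the
values, so that [phi|.|] being tangentially regular makes it paraconcave; for
[K = 0] this is convexity. *)
Definition paraconvex (K : R) (h : X -> R) := forall (x a b : X) (l : R),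
  0 <= l <= 1 -> l *: a + (1 - l) *: b = 0 ->
  h x <= l * h (x + a) + (1 - l) * h (x + b)
         + K * (l * phi `|a| + (1 - l) * phi `|b|).

Lemma paraconvex_cst (K c : R) : 0 <= K -> paraconvex K (fun=> c).
Proof.
move=> K0 x a b l /andP[l0 l1] _.
have := primitive0_ge0 homega (normr_ge0 a); have := primitive0_ge0 homega (normr_ge0 b).
move=> pb pa; have : 0 <= K * (l * phi `|a| + (1 - l) * phi `|b|).
  by rewrite mulr_ge0// addr_ge0// mulr_ge0// subr_ge0.
lra.
Qed.

(** Translates and averages stay paraconvex with the same constant: the closure
property that makes the largest paraconvex minorant also paraconcave. *)
Lemma paraconvex_average (K l c : R) (a b : X) (h : X -> R) : 0 <= l <= 1 ->
  paraconvex K h ->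
  paraconvex K (fun x => l * h (x + a) + (1 - l) * h (x + b) - c).
Proof.
move=> /andP[l0 l1] hK x a' b' l' hl' ab'.
have ha := ler_wpM2l l0 (hK (x + a) a' b' l' hl' ab').
have l10 : 0 <= 1 - l by lra.
have hb := ler_wpM2l l10 (hK (x + b) a' b' l' hl' ab').
rewrite ![x + _ + a]addrAC ![x + _ + b]addrAC; lra.
Qed.

Lemma paraconvex_sup (K : R) (H : set (X -> R)) : H !=set0 ->
  (forall x, has_ubound [set h x | h in H]) -> (forall h, H h -> paraconvex K h) ->
  paraconvex K (fun x => sup [set h x | h in H]).
Proof.
move=> [h0 Hh0] Hub HK x a b l hl ab.
apply: ge_sup; first by exists (h0 x), h0.
move=> _ [h Hh <-]; apply: (le_trans (HK h Hh x a b l hl ab)).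
have le_sup y : h y <= sup [set h y | h in H] 
  by apply: sup_upper_bound; [split; [exists (h0 y), h0|]|exists h].
by case/andP: hl => l0 l1; rewrite lerD2r lerD// ler_wpM2l// subr_ge0.
Qed.

(** The largest [K]-paraconvex function below [U] is the required [F]: that
[- F] is paraconvex is the statement that an average of translates of [F], once
lowered by the admissible error, still competes in the supremum. *)
Theorem paraconvex_insertion (K : R) (L U : set (X -> R)) :
    L !=set0 -> U !=set0 ->
    (forall l, L l -> paraconvex K l) -> (forall u, U u -> paraconvex K (\- u)) ->
    (forall l u x, L l -> U u -> l x <= u x) ->
  exists F, [/\ paraconvex K F, paraconvex K (\- F),
    forall l x, L l -> l x <= F x & forall u x, U u -> F x <= u x].
Proof.
move=> [l0 Ll0] [u0 Uu0] LK UK LU.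
pose H := [set h | paraconvex K h /\ forall u x, U u -> h x <= u x].
have LH l : L l -> H l by move=> Ll; split=> [|u x Uu]; [exact: LK|exact: LU].
have Hub x : has_ubound [set h x | h in H].
  by exists (u0 x) => _ [h [_ Hh] <-]; exact: Hh.
have H0 : H !=set0 by exists l0; exact: LH.
pose F x := sup [set h x | h in H].
have HF h x : H h -> h x <= F x.
  by move=> Hh; apply: sup_upper_bound; [split=> //; exists (h x), h|exists h].
have FU u x : U u -> F x <= u x.
  by move=> Uu; apply: ge_sup; [exists (l0 x), l0 => //; exact: LH|];
    move=> _ [h [_ Hh] <-]; exact: Hh.
have FK : paraconvex K F by apply: paraconvex_sup => // h [].
exists F; split=> //; last by move=> l x /LH; exact: HF.
move=> x a b l hl ab /=; case/andP: (hl) => l0' l1.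
pose c := K * (l * phi `|a| + (1 - l) * phi `|b|).
suff : l * F (x + a) + (1 - l) * F (x + b) - c <= F x by rewrite /c; lra.
apply: (HF (fun y => l * F (y + a) + (1 - l) * F (y + b) - c)); split.
  exact: paraconvex_average.
move=> u y Uu; have := UK u Uu y a b l hl ab; rewrite /= -/c.
have := ler_wpM2l l0' (FU u (y + a) Uu).
have l10 : 0 <= 1 - l by lra.
have := ler_wpM2l l10 (FU u (y + b) Uu); lra.
Qed.

End Paraconvex.
Arguments paraconvex {R X} omega K h.

Section Derivative.
Context {R : realType} {X : normedModType R} {omega : R -> R}.
Context (homega : modulus_of_continuity omega).
Local Notation phi := (primitive0 omega).

(** Paraconvexity at [x] along [x + t v] and [x - s v], with the weights that put
the barycenter at [x], divided by [s t / (s + t)]. *)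
Lemma paraconvex_slopes (K : R) (F : X -> R) (x v : X) (s t : R) :
  0 < s -> 0 < t -> paraconvex omega K F ->
  (F x - F (x - s *: v)) / s - (F (x + t *: v) - F x) / t
    <= K * (phi `|s *: v| / s + phi `|t *: v| / t).
Proof.
move=> s0 t0 /(_ x (t *: v) (- (s *: v)) (s / (s + t))) H.
have st0 : 0 < s + t by lra.
have l1 : 1 - s / (s + t) = t / (s + t) by field; lra.
have : F x <= s / (s + t) * F (x + t *: v) + t / (s + t) * F (x - s *: v) +
      K * (s / (s + t) * phi `|t *: v| + t / (s + t) * phi `|s *: v|).
  rewrite -l1 -(normrN (s *: v)); apply: H.
    by rewrite divr_ge0 ?(ltW s0) ?(ltW st0)// ler_pdivrMr// mul1r; lra.
  by rewrite l1 scalerN !scalerA -scalerBl (_ : _ - _ = 0) ?scale0r//; ring.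
rewrite -subr_ge0 => h; rewrite -subr_ge0.
have : 0 <= ((s + t) / (s * t)) *
  (s / (s + t) * F (x + t *: v) + t / (s + t) * F (x - s *: v) +
      K * (s / (s + t) * phi `|t *: v| + t / (s + t) * phi `|s *: v|) - F x).
  by rewrite mulr_ge0// divr_ge0 ?mulr_ge0 ?ltW.
congr (0 <= _); field; by rewrite ?gt_eqF.
Qed.

(** Left and right quotients bound each other up to errors that tend to 0 with
the step, so they have a common limit [d], obtained as the supremum of the left
quotients minus their error; the error in [t] is kept explicit by sending only
the opposite step to 0. *)
Lemma paraconvex_derivative (K : R) (F : X -> R) (x v : X) : 0 <= K ->
  paraconvex omega K F -> paraconvex omega K (\- F) ->
  exists d : R, forall t, `|F (x + t *: v) - F x - t * d| <= K * phi `|t *: v|.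
Proof.
move=> K0 F1 F2.
(* Error term, and right and left difference quotients. *)
pose p s := K * (phi `|s *: v| / s).
pose qr t := (F (x + t *: v) - F x) / t.
pose ql s := (F x - F (x - s *: v)) / s.
have h1 s t : 0 < s -> 0 < t -> ql s - p s <= qr t + p t.
  move=> s0 t0; have := paraconvex_slopes x v s0 t0 F1; rewrite /ql /qr /p; lra.
have h2 s t : 0 < s -> 0 < t -> qr t - p t <= ql s + p s.
  move=> s0 t0; have := paraconvex_slopes x v s0 t0 F2; rewrite /ql /qr /p /=; lra.
pose S := [set ql s - p s | s in [set s | 0 < s]].
have S0 : S !=set0 by exists (ql 1 - p 1), 1 => //=.
have Sub t : 0 < t -> ubound S (qr t + p t) by move=> t0 _ [s s0 <-]; exact: h1.
pose d := sup S.
have d1 s : 0 < s -> ql s - p s <= d.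
  move=> s0; apply: sup_upper_bound; last by exists s.
  by split=> //; exists (qr 1 + p 1); exact: Sub.
have d2 t : 0 < t -> d <= qr t + p t by move=> t0; apply: ge_sup => //; exact: Sub.
have p_small e : 0 < e -> exists2 s, 0 < s & p s <= e.
  move=> e0; have K1 : 0 < K + 1 by lra.
  have [s s0 Hs] := primitive0_little homega (normr_ge0 v) (divr_gt0 e0 K1).
  exists s => //; rewrite /p normrZ gtr0_norm//.
  apply: (@le_trans _ _ (K * (e / (K + 1)))).
    by rewrite ler_wpM2l// ler_pdivrMr// [leRHS]mulrC (Hs s)// lexx ltW.
  by rewrite mulrCA ler_piMr ?(ltW e0)// ler_pdivrMr//; lra.
have d3 t : 0 < t -> qr t - p t <= d.
  move=> t0; apply/ler_addgt0Pr => e e0.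
  have [|s s0 ps] := p_small (e / 2); first by lra.
  have := d1 s s0; have := h2 s t s0 t0; lra.
have d4 s : 0 < s -> d <= ql s + p s.
  move=> s0; apply/ler_addgt0Pr => e e0.
  have [|t t0 pt] := p_small (e / 2); first by lra.
  have := d2 t t0; have := h1 s t s0 t0; have := h2 s t s0 t0; lra.
exists d => t; have [t0|t0|->] := ltgtP t 0; last first.
- by rewrite !scale0r addr0 subrr mul0r subr0 !normr0 primitive0_0 mulr0.
- have := d2 t t0; have := d3 t t0.
  have -> : F (x + t *: v) - F x - t * d = t * (qr t - d).
    by rewrite /qr; field; exact: lt0r_neq0.
  have -> : K * phi `|t *: v| = t * p t by rewrite /p; field; exact: lt0r_neq0.
  by rewrite normrM gtr0_norm// ler_pM2l// ler_norml => ? ?; lra.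
- have Nt0 : 0 < - t by lra.
  have := d1 _ Nt0; have := d4 _ Nt0.
  have -> : F (x + t *: v) - F x - t * d = t * (ql (- t) - d).
    by rewrite /ql scaleNr opprK; field; exact: ltr0_neq0.
  have -> : K * phi `|t *: v| = - t * p (- t).
    by rewrite /p scaleNr normrN; field; exact: ltr0_neq0.
  by rewrite normrM ltr0_norm// ler_pM2l// ler_norml => ? ?; lra.
Qed.

(** Homogeneity compares the expansions along [v] and [c v]; additivity comes
from paraconvexity at the midpoint of [x + t u] and [x + t w]. *)
Lemma paraconvex_differential (K : R) (F : X -> R) (x : X) : 0 <= K ->
  paraconvex omega K F -> paraconvex omega K (\- F) ->
  exists D : X -> R, [/\ forall u v, D (u + v) = D u + D v,
    forall c v, D (c *: v) = c * D v &
    forall v, `|F (x + v) - F x - D v| <= K * phi `|v|].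
Proof.
move=> K0 F1 F2.
have /choice[D HD] v := paraconvex_derivative x v K0 F1 F2.
have phi_le t c c' : 0 < t -> 0 <= c -> c <= c' -> phi (t * c) <= phi (t * c').
  by move=> t0 c0 cc; apply: primitive0_le => //; [rewrite mulr_ge0 // ltW|rewrite ler_pM2l].
have uniq A c : 0 <= c -> (forall t, 0 < t -> `|t * A| <= 8 * K * phi (t * c)) -> A = 0.
  move=> c0 H; have K8 : 0 <= 8 * K by lra.
  apply/eqP; rewrite -normr_le0; apply: (primitive0_negligible homega K8 c0) => t t0.
  by have := H t t0; rewrite normrM gtr0_norm.
have DZ c v : D (c *: v) = c * D v.
  apply/subr0_eq/(uniq _ `|c *: v|) => // t t0.
  have h1 := HD (c *: v) t; have h2 := HD v (t * c).
  have tcv : `|(t * c) *: v| = t * `|c *: v| by rewrite -scalerA normrZ gtr0_norm.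
  rewrite scalerA tcv in h1; rewrite tcv in h2.
  have := mulr_ge0 K0 (primitive0_ge0 homega (mulr_ge0 (ltW t0) (normr_ge0 (c *: v)))).
  move: h1 h2; rewrite !ler_norml => /andP[? ?] /andP[? ?] ?.
  by apply/andP; split; lra.
exists D; split=> //; last by move=> v; have := HD v 1; rewrite !scale1r mul1r.
move=> u w; apply/subr0_eq.
pose m : X := 2^-1 *: (u + w); pose z : X := 2^-1 *: (u - w).
have -> : D (u + w) = 2 * D m by rewrite -DZ /m scalerA divff// scale1r.
apply: (uniq _ (`|u| + `|w|)); first by rewrite addr_ge0.
clear uniq.
move=> t t0.
have nt (y : X) : `|t *: y| = t * `|y| by rewrite normrZ gtr0_norm.
have zE : `|z| <= `|u| + `|w|.
  rewrite /z normrZ gtr0_norm ?invr_gt0//.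
  have := ler_normB u w; have := normr_ge0 u; have := normr_ge0 w; lra.
have mE : `|m| <= `|u| + `|w|.
  rewrite /m normrZ gtr0_norm ?invr_gt0//.
  have := ler_normD u w; have := normr_ge0 u; have := normr_ge0 w; lra.
have mid (h : X -> R) : paraconvex omega K h ->
    2 * h (x + t *: m) - h (x + t *: u) - h (x + t *: w) <= 2 * K * phi (t * `|z|).
  move=> /(_ (x + t *: m) (t *: z) (- (t *: z)) 2^-1).
  have mz : m + z = u.
    rewrite /m /z -scalerDr addrACA subrr addr0.
    by rewrite -(mulr2n u) -(scaler_nat 2 u) scalerA mulVf// scale1r.
  have mz' : m - z = w.
    rewrite /m /z -scalerBr opprD opprK addrACA subrr add0r.
    by rewrite -(mulr2n w) -(scaler_nat 2 w) scalerA mulVf// scale1r.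
  have half : 1 - 2^-1 = 2^-1 :> R by field.
  rewrite half scalerN subrr normrN -!addrA -scalerDr -scalerBr mz mz' nt.
  move=> H; suff : h (x + t *: m) <= 2^-1 * h (x + t *: u) + 2^-1 * h (x + t *: w)
      + K * (2^-1 * phi (t * `|z|) + 2^-1 * phi (t * `|z|)) by lra.
  by rewrite -addrA; apply: H => //; apply/andP; split; lra.
have := mid _ F1; have := mid _ F2 => /=.
have := HD u t; have := HD w t; have := HD m t.
rewrite !nt !ler_norml => /andP[a1 a2] /andP[b1 b2] /andP[c1 c2] m1 m2.
have pu := ler_wpM2l K0 (@phi_le t `|u| (`|u| + `|w|) t0 (normr_ge0 _) ltac:(by rewrite lerDl)).
have pw := ler_wpM2l K0 (@phi_le t `|w| (`|u| + `|w|) t0 (normr_ge0 _) ltac:(by rewrite lerDr)).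
have pm := ler_wpM2l K0 (@phi_le t `|m| (`|u| + `|w|) t0 (normr_ge0 _) mE).
have pz := ler_wpM2l K0 (@phi_le t `|z| (`|u| + `|w|) t0 (normr_ge0 _) zE).
apply/andP; split; lra.
Qed.

End Derivative.

(** * Regularity in Hilbert spaces *)

Section Regularity.
Context {R : realType} {X : completeNormedModType R} {dot : {dot X for idfun}}.
Context {omega : R -> R}.
Context (hdot : induces_norm dot).
Context (homega : modulus_of_continuity omega).
Local Notation phi := (primitive0 omega).

(** Averaging tangent inequalities over increments of barycenter 0 kills the
linear terms. *)
Lemma tangent_paraconvex (K : R) (h : X -> R) :
  (forall x, exists p, forall a, h x + dot p a - K * phi `|a| <= h (x + a)) ->
  paraconvex omega K h.
Proof.
move=> H x a b l /andP[l0 l1] ab; have [p Hp] := H x.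
have l10 : 0 <= 1 - l by lra.
have : l * dot p a + (1 - l) * dot p b = 0.
  by rewrite -!dotZr -linearDr ab linear0r.
have := ler_wpM2l l0 (Hp a); have := ler_wpM2l l10 (Hp b); lra.
Qed.

(** The slope is the gradient [omega|x| x / |x|] of [phi|.|]. By
[primitive0_tangent] it remains to bound [omega|x|] times the excess of
[|x + a| - |x|] over its linear part. When [|a| <= |x|] this excess is at most
[|a|^2 / (2 |x|)], by the Hilbert structure, and the slope of [omega] transfers
the factor to [|a|]; otherwise the excess is trivially at most [2 |a|]. The
constant is [4] from [primitive0_tangent] plus [8] from the second case. *)
Lemma primitive0_norm_tangent (x : X) :
  exists p : X, forall a, phi `|x + a| <= phi `|x| + dot p a + 12 * phi `|a|.
Proof.
have [->|x0] := eqVneq x 0.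
  exists 0 => a; rewrite add0r linear0l normr0 primitive0_0.
  have := primitive0_ge0 homega (normr_ge0 a); lra.
exists (omega `|x| / `|x| *: x) => a; rewrite dotZl.
have r0 : 0 < `|x| by rewrite normr_gt0.
have h1 := primitive0_tangent homega (ltW r0) (normr_ge0 (x + a)).
have d_le : `|(`|x + a| - `|x|)| <= `|a|.
  by have := ler_dist_dist (x + a) x; rewrite [x + a]addrC addrK.
have h2 := primitive0_le homega (normr_ge0 _) d_le.
have h3 := primitive0_lower homega (normr_ge0 a).
have wr := modulus_ge0 homega (ltW r0).
suff : omega `|x| * (`|x + a| - `|x| - dot x a / `|x|) <= 8 * phi `|a|.
  have -> : omega `|x| / `|x| * dot x a = omega `|x| * (dot x a / `|x|) by ring.
  lra.
have [ar|/ltW ra] := leP `|a| `|x|.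
  have h4 := modulus_slope homega (normr_ge0 a) ar.
  have h5 : `|x + a| - `|x| - dot x a / `|x| <= `|a| ^+ 2 / 2 / `|x|.
    rewrite -(ler_pM2r r0) divfK ?gt_eqF// mulrBl divfK ?gt_eqF//.
    have := sqr_normD hdot x a; have := sqr_ge0 (`|x + a| - `|x|); lra.
  apply: (le_trans (ler_wpM2l wr h5)).
  have h6 : omega `|x| * (`|a| ^+ 2 / 2 / `|x|) <= `|a| * omega `|a| / 2.
    rewrite !mulrA ler_pdivrMr//.
    have := ler_wpM2l (normr_ge0 a) h4; lra.
  have := primitive0_ge0 homega (normr_ge0 a); lra.
have h4 := modulus_le homega (ltW r0) ra.
have h5 : `|x + a| - `|x| - dot x a / `|x| <= 2 * `|a|.
  have : - (dot x a / `|x|) <= `|a|.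
    rewrite -mulNr ler_pdivrMr// mulrC.
    by have := dot_norm_le hdot x a; rewrite ler_norml => /andP[+ _]; lra.
  have := ler_norm (`|x + a| - `|x|); lra.
have w2 : 0 <= 2 * `|a| by rewrite mulr_ge0.
have := ler_wpM2l wr h5; have := ler_wpM2r w2 h4; lra.
Qed.

Lemma paraconvex_barrier (M c : R) (g y : X) : 0 <= M ->
  paraconvex omega (12 * M) (fun x => c + dot g (x - y) - M * phi `|x - y|).
Proof.
move=> M0; apply: tangent_paraconvex => x.
have [p Hp] := primitive0_norm_tangent (x - y).
exists (g - M *: p) => a; rewrite [x + a - y]addrAC linearBl linearDr /= dotZl.
have := ler_wpM2l M0 (Hp a); lra.
Qed.

(** First-order expansion with uniform error [K phi]; it contains all the
information of a [C^{1,omega}] bound. *)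
Definition taylor (K : R) (F : X -> R) (g : X -> X) :=
  forall x v, `|F (x + v) - F x - dot (g x) v| <= K * phi `|v|.

Lemma taylor_gradient (K : R) (F : X -> R) (g : X -> X) (x : X) : 0 <= K ->
  taylor K F g -> differentiable F x /\ gradient dot F x = g x.
Proof.
move=> K0 FT; pose D v : R^o := dot (g x) v.
have Dlin : linear D by move=> c u v; rewrite /D linearDr /= dotZr.
pose Dl : {linear X -> R^o} := HB.pack D (GRing.isLinear.Build R X R^o *:%R D Dlin).
have Dcont : continuous Dl.
  apply/linear_bounded_continuous/linear_boundedP.
  near=> r => v; apply: (le_trans (dot_norm_le hdot _ _)).
  by rewrite ler_wpM2r//; near: r; exact: nbhs_pinfty_ge.
have Do : F \o shift x = cst (F x) + Dl +o_ 0 id.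
  apply/eqaddoP => e e0; have K1 : 0 < K + 1 by lra.
  have [d d0 Hd] := primitive0_little homega ler01 (divr_gt0 e0 K1).
  near=> v.
  have vd : `|v| <= d by near: v; exact: nbhs0_le.
  have := FT x v; rewrite [x + v]addrC /= opprD addrA => h.
  apply: (le_trans h).
  have := Hd `|v|; rewrite mulr1 normr_ge0 vd => /(_ isT) h2.
  apply: (le_trans (ler_wpM2l K0 h2)).
  rewrite [leRHS]mulrC mulrCA ler_wpM2l// mulrCA ler_piMr ?(ltW e0)// ler_pdivrMr//; lra.
have dE := diff_unique Dcont Do.
have dF : differentiable F x by apply/diff_locallyP; rewrite dE.
split=> //; rewrite /gradient; apply: xget_unique.
  by move=> v; rewrite /= dE.
move=> g' /= Hg'; apply: (dot_inj hdot) => v; rewrite -Hg' dE//.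
Unshelve. all: by end_near. Qed.

(** Bounding a dual norm on a single sphere; the freedom of the radius is what
lets the increment have the size of [x - y] in [taylor_gradient_modulus]. *)
Lemma dot_norm_sphere (g : X) (B r : R) : 0 < r -> 0 <= B ->
  (forall v, `|v| = r -> dot g v <= B * r) -> `|g| <= B.
Proof.
move=> r0 B0 H; have [->|g0] := eqVneq g 0; first by rewrite normr0.
have ng : 0 < `|g| by rewrite normr_gt0.
have := H ((r / `|g|) *: g); rewrite normrZ normrM normfV normr_id gtr0_norm//.
rewrite divfK ?gt_eqF// dotZr hdot => /(_ erefl).
have -> : r / `|g| * `|g| ^+ 2 = `|g| * r by field; exact: lt0r_neq0.
by rewrite ler_pM2r.
Qed.

Lemma taylor_gradient_bounded (K N : R) (F : X -> R) (g : X -> X) (x : X) :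
  0 <= K -> 0 <= N -> (forall x, `|F x| <= N) -> taylor K F g ->
  `|g x| <= 2 * N + K * phi 1.
Proof.
move=> K0 N0 FN FT; apply: (dot_norm_sphere ltr01).
  by rewrite addr_ge0 ?mulr_ge0// primitive0_ge0.
move=> v v1; rewrite mulr1; have := FT x v; rewrite v1.
have := FN x; have := FN (x + v); rewrite !ler_norml.
by move=> /andP[? ?] /andP[? ?] /andP[? ?]; lra.
Qed.

(** Reach [x + v], with [|v| = |x - y|], from [y] directly and through [x]: the
three expansions differ by [dot (g x - g y) v] and their errors sum to at most
[6 K r omega r], where [r = |x - y|]. *)
Lemma taylor_gradient_modulus (K : R) (F : X -> R) (g : X -> X) (x y : X) :
  0 <= K -> taylor K F g -> `|g x - g y| <= 6 * K * omega `|x - y|.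
Proof.
move=> K0 FT; have [->|xy] := eqVneq x y.
  by rewrite !subrr normr0 (modulus0 homega) mulr0.
set r := `|x - y|; have r0 : 0 < r by rewrite normr_gt0 subr_eq0.
have w0 := modulus_ge0 homega (ltW r0).
apply: (dot_norm_sphere r0); first by rewrite !mulr_ge0.
move=> v vr; rewrite linearBl/=.
have := FT x v; have := FT y (x - y); have := FT y ((x - y) + v).
rewrite addrA [y + (x - y)]addrC subrK linearDr /= vr -/r.
have h1 : phi `|x - y + v| <= 4 * (r * omega r).
  have le2 : `|x - y + v| <= 2 * r by apply: (le_trans (ler_normD _ _)); rewrite vr -/r; lra.
  have r2 : 0 <= 2 * r by lra.
  apply: (le_trans (primitive0_le homega (normr_ge0 _) le2)).
  apply: (le_trans (primitive0_upper homega r2)).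
  have := @modulus_slope _ _ homega r (2 * r) (ltW r0) ltac:(lra).
  rewrite -subr_ge0 => h; have : 0 <= 2 * (2 * r * omega r - r * omega (2 * r)) by lra.
  lra.
have h2 := primitive0_upper homega (ltW r0).
have h1' := ler_wpM2l K0 h1; have h2' := ler_wpM2l K0 h2.
rewrite !ler_norml => /andP[a1 a2] /andP[b1 b2] /andP[c1 c2]; lra.
Qed.

(** Boundedness of [F] makes the differentials bounded forms, which the Riesz
theorem turns into a gradient field. *)
Theorem paraconvex_taylor (K N : R) (F : X -> R) : 0 <= K ->
  (forall x, `|F x| <= N) -> paraconvex omega K F -> paraconvex omega K (\- F) ->
  exists g, taylor K F g.
Proof.
move=> K0 FN F1 F2.
suff /choice[g Hg] x : exists p, forall v, `|F (x + v) - F x - dot p v| <= K * phi `|v|.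
  by exists g.
have [D [DD DZ DT]] := paraconvex_differential homega x K0 F1 F2.
have D1 v : `|v| = 1 -> `|D v| <= 2 * N + K * phi 1.
  move=> v1; have := DT v; have := FN x; have := FN (x + v); rewrite v1 !ler_norml.
  move=> /andP[? ?] /andP[? ?] /andP[? ?]; apply/andP; split; lra.
have D0 : D 0 = 0 by rewrite -(scale0r (0 : X)) DZ mul0r.
have [|g Hg] := @riesz _ _ _ hdot D (2 * N + K * phi 1) DD DZ.
  move=> v; have [->|v0] := eqVneq v 0; first by rewrite D0 !normr0 mulr0.
  have nv : 0 < `|v| by rewrite normr_gt0.
  rewrite -ler_pdivrMr// mulrC -{1}(gtr0_norm nv) -normfV -normrM -DZ D1//.
  by rewrite normrZ normfV normr_id mulVf// gt_eqF.
by exists g => v; rewrite -Hg.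
Qed.

End Regularity.
Arguments taylor {R X} dot omega K F g.

(** * Extension of bounded jets *)

Section Extension.
Context {R : realType} {X : completeNormedModType R} {dot : {dot X for idfun}}.
Context {omega : R -> R}.
Context (hdot : induces_norm dot).
Context (homega : modulus_of_continuity omega).
Local Notation phi := (primitive0 omega).

(** The insertion theorem applied to the barriers of the jet together with the
constants [- M (1 + T)] and [M (1 + T)]. *)
Theorem jet_extension (E : set X) (f : E -> R) (G : E -> X) (M T : R) :
    0 <= M -> (forall t, 0 <= t -> t - phi t <= T) ->
    (forall y, `|f y| <= M) -> (forall y, `|G y| <= M) ->
    (forall x y z, `|f y + dot (G y) (x - val y) - f z - dot (G z) (x - val z)|
       <= M * (phi `|x - val y| + phi `|x - val z|)) ->
  exists F g, [/\ taylor dot omega (12 * M) F g,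
    forall x, `|F x| <= M * (1 + T) &
    forall y : E, F (val y) = f y /\ g (val y) = G y].
Proof.
move=> M0 HT fM GM fG; pose N := M * (1 + T).
have T0 : 0 <= T by have := HT 0 (lexx 0); rewrite primitive0_0 subr0.
have N0 : 0 <= N by rewrite mulr_ge0//; lra.
pose low y x := f y + dot (G y) (x - val y) - M * phi `|x - val y|.
pose upp y x := f y + dot (G y) (x - val y) + M * phi `|x - val y|.
have dG x (y : E) : `|dot (G y) (x - val y)| <= M * `|x - val y|.
  by apply: (le_trans (dot_norm_le hdot _ _)); rewrite ler_wpM2r.
have lowN y x : low y x <= N.
  have := ler_wpM2l M0 (HT _ (normr_ge0 (x - val y))).
  move: (fM y) (dG x y); rewrite !ler_norml => /andP[? ?] /andP[? ?].
  rewrite /low /N; lra.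
have uppN y x : - N <= upp y x.
  have := ler_wpM2l M0 (HT _ (normr_ge0 (x - val y))).
  move: (fM y) (dG x y); rewrite !ler_norml => /andP[? ?] /andP[? ?].
  rewrite /upp /N; lra.
have lowupp y z x : low y x <= upp z x.
  by have := fG x y z; rewrite ler_norml /low /upp => /andP[? ?]; lra.
pose L := [set l | l = (fun=> - N) \/ exists y, l = low y].
pose U := [set u | u = (fun=> N) \/ exists y, u = upp y].
have [|||||F [F1 F2 LF FU]] := @paraconvex_insertion _ _ omega (12 * M) L U.
- by exists (fun=> - N); left.
- by exists (fun=> N); left.
- move=> _ [->|[y ->]]; first by apply: paraconvex_cst => //; lra.
  exact: paraconvex_barrier.
- move=> _ [->|[y ->]]; first by apply: (@paraconvex_cst _ _ _ homega _ (- N)); lra.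
  have -> : \- upp y = (fun x => - f y + dot (- G y) (x - val y) - M * phi `|x - val y|).
    by apply/funext => x; rewrite /upp /= linearNl; ring.
  exact: paraconvex_barrier.
- move=> _ _ x [->|[y ->]] [->|[z ->]]; [lra|exact: uppN|exact: lowN|exact: lowupp].
have FN x : `|F x| <= N.
  by rewrite ler_norml (LF (fun=> - N)) ?(FU (fun=> N))//; left.
have K0 : 0 <= 12 * M by lra.
have [g FT] := paraconvex_taylor hdot homega K0 FN F1 F2.
have lowF y x : low y x <= F x by apply: LF; right; exists y.
have Fupp y x : F x <= upp y x by apply: FU; right; exists y.
have Ff (y : E) : F (val y) = f y.
  have := lowF y (val y); have := Fupp y (val y).
  rewrite /low /upp subrr normr0 linear0r primitive0_0; lra.
exists F, g; split=> // y; split=> //; apply: (dot_inj hdot).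
suff le0 w : dot (g (val y)) w - dot (G y) w <= 0.
  move=> w; have := le0 w; have := le0 (- w); rewrite !linearNr/=; lra.
have K13 : 0 <= 13 * M by lra.
apply: (primitive0_negligible homega K13 (normr_ge0 w)) => t t0.
have := FT (val y) (t *: w); have := Fupp y (val y + t *: w).
rewrite /upp [val y + _ - _]addrAC subrr add0r Ff !dotZr normrZ gtr0_norm//.
by rewrite ler_norml => ? /andP[? ?]; lra.
Qed.

End Extension.

Section SupGe0.
Context {R : realType}.
Implicit Types (S : set R) (r B : R).

Lemma sup_ge0_ge0 S : (0 <= sup_ge0 S)%E.
Proof. by apply: ereal_sup_ubound; left. Qed.

Lemma sup_ge0_ubound S r : S r -> (r%:E <= sup_ge0 S)%E.
Proof. by move=> Sr; apply: ereal_sup_ubound; right; exists r. Qed.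

Lemma sup_ge0_le S B : 0 <= B -> (forall r, S r -> r <= B) -> (sup_ge0 S <= B%:E)%E.
Proof.
move=> B0 SB; apply: ge_ereal_sup => _ [->|[r Sr <-]]; rewrite lee_fin//.
exact: SB.
Qed.

Lemma sup_norm_lty (T : Type) (V : normedModType R) (f : T -> V) :
  bounded_fun f -> (sup_norm f < +oo)%E.
Proof.
move=> [B [_ HB]]; pose B1 := `|B| + 1.
have BB1 : B < B1 by have := ler_norm B; rewrite /B1; lra.
apply: (@le_lt_trans _ _ B1%:E); last exact: ltry.
apply: sup_ge0_le; first by rewrite addr_ge0.
by move=> _ [x _ <-]; exact: HB.
Qed.

Lemma bounded_funP (T : Type) (V : normedModType R) (f : T -> V) B :
  (forall x, `|f x| <= B) -> bounded_fun f.
Proof.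
move=> fB; exists B; split; first exact: num_real.
by move=> r Br x _; apply: (le_trans (fB x)); exact: ltW.
Qed.

End SupGe0.

(** The extension is chosen jet by jet, with [M] the norm of the jet; the sum of
the three bounds [N], [2 N + K phi 1] and [6 K], for [N = M (1 + T)] and
[K = 12 M], is [C M]. *)
Theorem theorem4p1 (R : realType) (omega : R -> R)
    (homega : modulus_of_continuity omega) :
  exists C : R, 0 < C /\
    forall (X : completeNormedModType R) (dot : {dot X for idfun})
      (hdot : induces_norm dot) (E : set X) (hE : E !=set0),
    exists Ext : jets_b dot omega (E := E) -> C1b dot omega,
      (forall fG : jets_b dot omega (E := E), forall y : E,
        val (Ext fG) (val y) = (val fG).1 y /\
        gradient dot (val (Ext fG)) (val y) = (val fG).2 y) /\
      (forall fG : jets_b dot omega (E := E),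
        (C1b_norm dot omega (val (Ext fG))
          <= C%:E * jets_b_norm dot omega (val fG))%E).
Proof.
have [T T0 HT] := primitive0_superlinear homega.
have phi1 := primitive0_ge0 homega (@ler01 R).
pose C := 3 * (1 + T) + 12 * primitive0 omega 1 + 72.
exists C; split; first by rewrite /C; lra.
move=> X dot hdot E hE.
suff /choice[Ext HExt] (fG : jets_b dot omega (E := E)) :
    exists h : C1b dot omega,
    (forall y : E, val h (val y) = (val fG).1 y /\
       gradient dot (val h) (val y) = (val fG).2 y) /\
    (C1b_norm dot omega (val h) <= C%:E * jets_b_norm dot omega (val fG))%E.
  by exists Ext; split=> fG; [exact: (HExt fG).1|exact: (HExt fG).2].
case: fG => -[f G] /= HfG; have := HfG; rewrite inE => -[/= Afin bf bG].
have sf := sup_norm_lty bf; have sG := sup_norm_lty bG.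
have f0 : (0 <= sup_norm f)%E := sup_ge0_ge0 _.
have G0 : (0 <= sup_norm G)%E := sup_ge0_ge0 _.
have A0 : (0 <= jet_seminorm dot omega f G)%E := sup_ge0_ge0 _.
have [M ME] : exists M, jets_b_norm dot omega (f, G) = M%:E.
  exists (fine (jets_b_norm dot omega (f, G))); rewrite fineK// /jets_b_norm/=.
  by rewrite !fin_numD !ge0_fin_numE// sf sG Afin.
have fM y : `|f y| <= M.
  rewrite -lee_fin -ME /jets_b_norm/= -addeA.
  apply: le_trans (leeDl _ (adde_ge0 G0 A0)).
  by apply: sup_ge0_ubound; exists y.
have GM y : `|G y| <= M.
  rewrite -lee_fin -ME /jets_b_norm/=.
  apply: le_trans (leeDl _ A0); apply: le_trans (leeDr _ f0).
  by apply: sup_ge0_ubound; exists y.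
have M0 : 0 <= M by rewrite -lee_fin -ME; rewrite !adde_ge0.
have fGM x (y z : E) : `|f y + dot (G y) (x - val y) - f z - dot (G z) (x - val z)|
    <= M * (primitive0 omega `|x - val y| + primitive0 omega `|x - val z|).
  have [d0|d0] := ltP 0 (`|x - val y| + `|x - val z|); last first.
    have [y0 z0] : `|x - val y| = 0 /\ `|x - val z| = 0.
      by have := normr_ge0 (x - val y); have := normr_ge0 (x - val z); split; lra.
    have yz : y = z.
      apply: val_inj; move/eqP: y0; move/eqP: z0; rewrite !normr_eq0 !subr_eq0.
      by move=> /eqP <- /eqP <-.
    by rewrite yz z0 -addrA -opprD subrr normr0 primitive0_0 addr0 mulr0.
  have p0 : 0 < primitive0 omega `|x - val y| + primitive0 omega `|x - val z|.
    have py := primitive0_ge0 homega (normr_ge0 (x - val y)).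
    have pz := primitive0_ge0 homega (normr_ge0 (x - val z)).
    have [y0|y0] := ltP 0 `|x - val y|.
      by have := primitive0_gt0 homega y0; lra.
    have z0 : 0 < `|x - val z| by lra.
    by have := primitive0_gt0 homega z0; lra.
  rewrite -ler_pdivrMr// -lee_fin -ME /jets_b_norm/=.
  apply: le_trans (leeDr _ (adde_ge0 f0 G0)).
  by apply: sup_ge0_ubound; exists x, y, z.
have [F [g [FT FN Fy]]] := jet_extension hdot homega M0 HT fM GM fGM.
have K0 : 0 <= 12 * M by lra.
have N0 : 0 <= M * (1 + T) by rewrite mulr_ge0//; lra.
have Fd x := taylor_gradient hdot homega x K0 FT.
have gE : gradient dot F = g by apply/funext => x; exact: (Fd x).2.
have gB x := taylor_gradient_bounded hdot homega x K0 N0 FN FT.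
have gH : (grad_seminorm dot omega F <= (6 * (12 * M))%:E)%E.
  apply: sup_ge0_le; first by lra.
  move=> _ [x [y [xy ->]]]; rewrite gE ler_pdivrMr.
    exact: taylor_gradient_modulus.
  by apply: modulus_gt0 => //; rewrite normr_gt0 subr_eq0; exact/eqP.
have HF : F \in C1b dot omega.
  rewrite inE; split.
  - split=> [x|]; [exact: (Fd x).1|exact: le_lt_trans gH (ltry _)].
  - exact: bounded_funP FN.
  - by rewrite gE; exact: bounded_funP gB.
exists (exist _ F HF); split=> /= [y|]; first by rewrite gE; exact: Fy.
rewrite /C1b_norm ME -EFinM.
have -> : C * M = M * (1 + T) + (2 * (M * (1 + T)) + 12 * M * primitive0 omega 1)
    + 6 * (12 * M) by rewrite /C; ring.
rewrite EFinD; apply: leeD; last exact: gH.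
rewrite EFinD; apply: leeD.
  by apply: sup_ge0_le => // _ [x _ <-]; exact: FN.
rewrite gE; apply: sup_ge0_le; first by rewrite addr_ge0 ?(mulr_ge0 K0)// mulr_ge0.
by move=> _ [x _ <-]; exact: gB.
Qed.
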